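(* Let $b$ be a complex-valued function on the class of graphs with non-empty vertex set. For a graph $G$ with $n=|V(G)|$ define $a_k(G)=\sum_{\{S_1,\dots,S_k\}}b(G[S_1])\cdots b(G[S_k])$, the sum over all partitions of $V(G)$ into exactly $k$ non-empty sets, and $f_b(G,x)=\sum_{k=1}^n a_k(G)x^k$ (with $f_b(\emptyset,x)=1$). Then: (a) for every such $b$, the graph polynomial $f_b$ is of exponential type; (b) for every graph polynomial $f$ of exponential type, letting $b(G)$ be the coefficient of $x^1$ in $f(G,x)$ for non-empty $G$, we have $f(G,x)=f_b(G,x)$ for all graphs $G$.
   Context: All graphs are finite simple graphs (the empty graph allowed). A graph polynomial assigns to each graph $G$ a polynomial $f(G,x)\in\mathbb{C}[x]$. It is of exponential type if $f(\emptyset,x)=1$ and for every graph $G$, $\sum_{S\subseteq V(G)}f(G[S],x)f(G[V(G)\setminus S],y)=f(G,x+y)$, where $G[S]$ denotes the induced subgraph on $S$. *)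

(* Defs.v *)
From HB Require Import structures.
From mathcomp Require Import all_boot all_order all_algebra.
From mathcomp Require Import finmap reals.
From mathcomp Require Export complex.

Set Implicit Arguments.
Unset Strict Implicit.
Unset Printing Implicit Defensive.

Import GRing.Theory.
Local Open Scope fset_scope.
Local Open Scope ring_scope.

(* Finite simple graphs whose vertices are taken from K, as a vertex set
   together with a set of two-element subsets of it.  Graphs are literal
   objects rather than vertex types: G[V(G)] = G and G[S][T] = G[T] hold as
   equalities, so functions on graphs need not be assumed invariant under
   isomorphism. *)
Record graph (K : choiceType) := Graph {
  vset : {fset K};
  eset : {fset {fset K}};
  esetP : eset `<=` [fset e in fpowerset vset | (#|` e| == 2)%N]
}.

Section GraphOperations.
Variable K : choiceType.

Definition graph0 : graph K := @Graph K fset0 fset0 (fsub0set _).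

Variables (G : graph K) (S : {set vset G}).

Definition induced_vset : {fset K} := [fset val v | v in S].

Definition induced_eset : {fset {fset K}} :=
  [fset e in eset G | e `<=` induced_vset].

Lemma induced_esetP :
  induced_eset `<=` [fset e in fpowerset induced_vset | (#|` e| == 2)%N].
Proof.
apply/fsubsetP=> e; rewrite !inE /= fpowersetE => /andP[eG ->] /=.
by have /fsubsetP/(_ _ eG) := esetP G; rewrite !inE /= => /andP[].
Qed.

Definition induced : graph K := Graph induced_esetP.

End GraphOperations.

Section ExponentialType.
Variables (R : realType) (K : choiceType).

Definition exponential_type (f : graph K -> {poly R[i]}) : Prop :=
  f (graph0 K) = 1 /\
  forall (G : graph K) (x y : R[i]),
    \sum_(S : {set vset G}) (f (induced S)).[x] * (f (induced (~: S))).[y]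
    = (f G).[x + y].

(* The blocks of a partition are non-empty, so the value of b at the empty
   graph is never used. *)
Definition partition_coef (b : graph K -> R[i]) (k : nat) (G : graph K) : R[i] :=
  \sum_(P : {set {set vset G}} | partition P [set: vset G] && (#|P| == k)%N)
    \prod_(S in P) b (induced S).

Definition partition_poly (b : graph K -> R[i]) (G : graph K) : {poly R[i]} :=
  if vset G == fset0 then 1
  else \sum_(1 <= k < #|` vset G|.+1) partition_coef b k G *: 'X^k.

End ExponentialType.

(* Main.v *)
Require Import Defs.
From HB Require Import structures.
From mathcomp Require Import all_boot all_order all_algebra.
From mathcomp Require Import finmap reals complex.

Set Implicit Arguments.
Unset Strict Implicit.
Unset Printing Implicit Defensive.

Import GRing.Theory.
Local Open Scope ring_scope.

(** For (a), the value of f_b at x is the sum over all partitions of the product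
    of the b(B) x over the blocks B.  At x + y every block carries the factor
    b(B) x + b(B) y; expanding the product distributes the blocks over x and y,
    which splits the vertex set into two parts, each with a partition.
    For (b), a graph polynomial of exponential type is determined by its linear
    coefficients, and the linear coefficient of f_b is b. *)

(** * Partitions of finite sets and sums over them *)

Lemma prodrD_subset (F : comNzRingType) (I : finType) (P : {set I}) (f g : I -> F) :
  \prod_(i in P) (f i + g i) =
  \sum_(J : {set I} | J \subset P) (\prod_(i in J) f i) * \prod_(i in P :\: J) g i.
Proof.
(* Outside [P] the extended factors are 0 and 1: each such factor of the product is 0 + 1 = 1, and
   in the full expansion every [J] not contained in [P] picks up a zero. *)
pose f' i := if i \in P then f i else 0.
pose g' i := if i \in P then g i else 1.
transitivity (\prod_i (f' i + g' i)).
  rewrite [LHS]big_mkcond; apply: eq_bigr => i _.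
  by rewrite /f' /g'; case: ifP; rewrite ?add0r.
rewrite bigA_distr (bigID (fun J : {set I} => J \subset P)) /= [X in _ + X]big1 ?addr0.
  apply: eq_bigr => J sJP.
  rewrite (bigID (mem J)) /=; congr (_ * _).
    apply: eq_bigr => i iJ; rewrite iJ /f'.
    by rewrite (subsetP sJP).
  rewrite [LHS]big_mkcond [RHS]big_mkcond; apply: eq_bigr => i _.
  by rewrite in_setD /g'; case: (i \in J); case: (i \in P).
move=> J /subsetPn[i iJ iP].
by rewrite (bigD1 i) //= iJ /f' (negbTE iP) mul0r.
Qed.

Lemma partition_setU (T : finType) (P Q : {set {set T}}) (D E : {set T}) :
  [disjoint D & E] -> partition P D -> partition Q E ->
  partition (P :|: Q) (D :|: E).
Proof.
move=> dDE /and3P[/eqP cP tP nP] /and3P[/eqP cQ tQ nQ]; apply/and3P; split.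
- by rewrite /cover bigcup_setU -/(cover P) -/(cover Q) cP cQ.
- by rewrite trivIsetU // cP cQ.
- by rewrite inE negb_or nP.
Qed.

Lemma partition_disjoint (T : finType) (P Q : {set {set T}}) (D E : {set T}) :
  [disjoint D & E] -> partition P D -> partition Q E -> [disjoint P & Q].
Proof.
move=> dDE pP pQ; apply/pred0P => B /=; apply/negP => /andP[BP BQ].
have /set0Pn[x xB] := partition_neq0 pP BP.
have xD := subsetP (partitionS pP BP) x xB.
by have := disjointFr dDE xD; rewrite (subsetP (partitionS pQ BQ) x xB).
Qed.

Lemma partition_subset (T : finType) (P Q : {set {set T}}) (D : {set T}) :
  partition P D -> Q \subset P -> partition Q (cover Q).
Proof.
move=> /and3P[_ tP nP] sQP; apply/and3P; split => //; first exact: trivIsetS tP.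
by apply: contra nP; apply: (subsetP sQP).
Qed.

Lemma cover_setD (T : finType) (P Q : {set {set T}}) :
  trivIset P -> Q \subset P -> cover (P :\: Q) = cover P :\: cover Q.
Proof.
move=> /trivIsetP tP sQP; apply/setP => x; rewrite inE.
apply/bigcupP/andP => [[B /setDP[BP nBQ] xB]|[nxQ /bigcupP[B BP xB]]].
  split; last by apply/bigcupP; exists B.
  apply/bigcupP => -[C CQ xC].
  have nBC : B != C by apply: contraNneq nBQ => ->.
  by have := disjointFr (tP _ _ BP (subsetP sQP _ CQ) nBC) xB; rewrite xC.
exists B => //; rewrite inE BP andbT.
by apply: contra nxQ => BQ; apply/bigcupP; exists B.
Qed.

Lemma card_partition_bounds (T : finType) (P : {set {set T}}) (D : {set T}) :
  D != set0 -> partition P D -> (1 <= #|P| < #|D|.+1)%N.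
Proof.
move=> nD pP; rewrite ltnS (card_partition pP) -sum1_card leq_sum ?andbT.
  rewrite sum1_card card_gt0; apply: contraNneq nD => P0.
  by rewrite -(cover_partition pP) P0 /cover big_set0.
by move=> B BP; rewrite card_gt0 (partition_neq0 pP).
Qed.

Lemma partition_imset (T U : finType) (h : T -> U) (P : {set {set T}}) (D : {set T}) :
  injective h ->
  partition [set h @: B | B : {set T} in P] (h @: D) = partition P D.
Proof.
move=> injh; have injH := imset_inj injh.
have covE : cover [set h @: B | B : {set T} in P] = h @: cover P.
  by rewrite cover_imset imset_cover.
rewrite /partition covE (inj_eq injH); congr [&& _, _ & _].
- rewrite /trivIset covE big_imset /=; last by move=> ? ? _ _; apply: injH.
  by rewrite card_imset //; congr (_ == _); apply: eq_bigr => B _; rewrite card_imset.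
- by congr (~~ _); rewrite -(mem_imset _ _ injH) imset0.
Qed.

Section PartitionSum.
Variables (F : comNzRingType) (T : finType).
Implicit Types (c : {set T} -> F) (D : {set T}).

Definition partition_sum c D : F :=
  \sum_(P : {set {set T}} | partition P D) \prod_(B in P) c B.

(* A partition P of T together with a subset Q of its blocks is the same as a
   set S = cover Q with a partition of S and a partition of its complement. *)
Lemma partition_sumD c d :
  partition_sum (fun B => c B + d B) setT =
  \sum_(S : {set T}) partition_sum c S * partition_sum d (~: S).
Proof.
rewrite /partition_sum; under eq_bigr do rewrite prodrD_subset.
rewrite pair_big_dep /= (partition_big (fun p => cover p.2) xpredT) //=.
apply: eq_bigr => S _; rewrite big_distrlr /= pair_big_dep /=.
(* Partitions [Q] of [S] and [Q'] of its complement give the pair of the partition [Q :|: Q'] and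
   its subset [Q]; the way back is to remove [Q] from the union. *)
rewrite (reindex_onto (fun q : {set {set T}} * {set {set T}} => (q.1 :|: q.2, q.1))
   (fun p => (p.2, p.1 :\: p.2))) /=; last first.
  move=> [P Q] /= /andP[/andP[_ sQP] _]; congr (_, _).
  by rewrite setDE setUIr setUCr setIT; apply/setUidPr.
apply: eq_big => [[Q Q'] | [Q Q']] /=.
  rewrite subsetUl andbT; apply/andP/andP => [[/andP[pP /eqP <-] /eqP[<-]]|[pQ pQ']].
    have sQ := subsetUl Q Q'; have tP := partition_trivIset pP.
    split; first exact: partition_subset pP sQ.
    have := partition_subset pP (subsetDl (Q :|: Q') Q).
    by rewrite cover_setD // (cover_partition pP) setTD.
  have dS : [disjoint S & ~: S] by rewrite -setI_eq0 setICr.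
  rewrite -(setUCr S) partition_setU // (cover_partition pQ) eqxx; split => //.
  (* Removing [Q] from the union returns [Q'] because the two share no block: blocks are non-empty
     and lie in disjoint sets. *)
  apply/eqP; congr (_, _); rewrite setDUl setDv set0U; apply/setDidPl.
  by rewrite disjoint_sym (partition_disjoint dS).
by move=> /andP[_ /eqP[->]].
Qed.

Lemma partition_sum_imset (U : finType) (h : U -> T) c (D : {set U}) :
  injective h ->
  partition_sum c (h @: D) =
  \sum_(P : {set {set U}} | partition P D) \prod_(B in P) c (h @: B).
Proof.
move=> injh; have injH := imset_inj injh.
rewrite /partition_sum (reindex_onto
   (fun P : {set {set U}} => [set h @: B | B : {set U} in P])
   (fun P => [set h @^-1: B | B : {set T} in P])) /=; last first.
  (* Preimages undo images here because every block of [P] lies in the image of [h]. *)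
  move=> P pP; rewrite -imset_comp -[RHS]imset_id; apply: eq_in_imset => B BP /=.
  have sB : B \subset h @: D by apply: partitionS pP BP.
  apply/setP => x; apply/imsetP/idP => [[y]|xB]; first by rewrite inE => yB ->.
  have /imsetP[y _ xy] := subsetP sB x xB.
  by exists y; rewrite // inE -xy.
apply: eq_big => [P|P _].
  rewrite partition_imset // -imset_comp -[X in _ == X]imset_id.
  rewrite (_ : (_ == _) = true) ?andbT //; apply/eqP; apply: eq_imset => B /=.
  by apply/setP => x; rewrite inE mem_imset.
by rewrite big_imset //= => ? ? _ _; apply: injH.
Qed.

End PartitionSum.

(** * Induced subgraphs and their nesting *)

Section Graphs.
Variable K : choiceType.
Implicit Types G H : graph K.

Lemma graph_ext G H : vset G = vset H -> eset G = eset H -> G = H.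
Proof.
case: G H => [V E p] [V' E' q] /= eV eE.
by subst V' E'; rewrite (bool_irrelevance p q).
Qed.

Lemma vset0_graph0 G : vset G = fset0 -> G = graph0 K.
Proof.
move=> V0; apply: graph_ext => //=; apply/fsetP => e; rewrite inE.
apply/negP => /(fsubsetP (esetP G)); rewrite V0 !inE /= fpowersetE fsubset0.
by case/andP => /eqP ->; rewrite cardfs0.
Qed.

Lemma induced_setT G : induced [set: vset G] = G.
Proof.
have VE : induced_vset [set: vset G] = vset G.
  apply/fsetP => v; apply/imfsetP/idP => [[x _ ->]|vG]; first exact: valP.
  by exists [` vG]%fset; rewrite ?inE.
apply: graph_ext => //=; apply/fsetP => e; rewrite !inE /= VE.
apply/andP/idP => [[]|eG] //; split => //.
by have /fsubsetP/(_ _ eG) := esetP G; rewrite !inE /= fpowersetE => /andP[].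
Qed.

Lemma induced_set0 G : induced (set0 : {set vset G}) = graph0 K.
Proof.
apply: vset0_graph0; apply/fsetP => v; rewrite inE.
by apply/imfsetP => -[x]; rewrite inE.
Qed.

Lemma card_induced G (S : {set vset G}) : #|` vset (induced S)| = #|S|.
Proof. by rewrite /= card_imfset ?cardE //; apply: val_inj. Qed.

Section Nested.
Variables (G : graph K) (S : {set vset G}).

Lemma induced_vset_sub : (vset (induced S) `<=` vset G)%fset.
Proof. exact: fset_sub_val. Qed.

Definition induced_incl : vset (induced S) -> vset G := fincl induced_vset_sub.

Lemma induced_incl_inj : injective induced_incl.
Proof. by move=> x y /(congr1 val) /= /val_inj. Qed.

Lemma induced_incl_imset : induced_incl @: setT = S.
Proof.
apply/setP => v; apply/imsetP/idP => [[x _ ->]|vS].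
  have /imfsetP[/= w wS xw] := valP x.
  by rewrite (_ : induced_incl x = w) //; apply: val_inj.
have vi : val v \in vset (induced S) by apply/imfsetP; exists v.
by exists [` vi]%fset => //; apply: val_inj.
Qed.

(** Both sides have the same vertices and edges in [K], although the vertex sets are subsets of
    different types. Being an equality, it lets an arbitrary [b] be evaluated on blocks of
    [induced S] as on blocks inside [G]. *)
Lemma induced_induced (B : {set vset (induced S)}) :
  induced B = induced (induced_incl @: B).
Proof.
have VE : induced_vset B = induced_vset (induced_incl @: B).
  apply/fsetP => v; apply/imfsetP/imfsetP => [[x xB ->]|[y /imsetP[x xB ->] ->]].
    by exists (induced_incl x); rewrite //= mem_imset //; apply: induced_incl_inj.
  by exists x.
apply: graph_ext => //=; apply/fsetP => e; rewrite !inE /= -VE -andbA.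
congr (_ && _); apply/andP/idP => [[]|eB] //; split => //.
exact/(fsubset_trans eB)/fset_sub_val.
Qed.

End Nested.

End Graphs.

(** * The partition polynomial: evaluation, exponential type, linear coefficient *)

Section PartitionPoly.
Variables (R : realType) (K : choiceType).
Implicit Types (b : graph K -> R[i]) (G : graph K).

(** A partition into k blocks is weighted by x^k, which is one factor x for each block; this removes
    the grouping by k. *)
Lemma horner_partition_poly b G x :
  (partition_poly b G).[x] = partition_sum (fun B => b (induced B) * x) [set: vset G].
Proof.
rewrite /partition_poly; case: eqP => [V0|/eqP nV0].
  have T0 : [set: vset G] = set0.
    by apply/eqP; rewrite -cards_eq0 cardsT -cardfE V0 cardfs0.
  (* The empty set has only the empty partition, whose empty product is the constant 1. *)
  rewrite /partition_sum T0 hornerC (eq_bigl (pred1 set0)); last first.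
    by move=> P; rewrite partition_set0.
  by rewrite big_pred1_eq big_set0.
have nT : [set: vset G] != set0 by rewrite -card_gt0 cardsT -cardfE cardfs_gt0.
rewrite horner_sum /partition_sum big_nat; under eq_bigr do rewrite hornerZ hornerXn.
rewrite -big_nat /partition_coef; under eq_bigr do rewrite mulr_suml.
rewrite (exchange_big_dep (fun P => partition P [set: vset G])) /=; last first.
  by move=> k P _ /andP[].
apply: eq_bigr => P pP; rewrite big_split prodr_const /= big_mkcond /=.
have kP := card_partition_bounds nT pP.
(* After the exchange, a fixed [P] occurs only at k = [#|P|], which [kP] places in the summation
   range. *)
rewrite (bigD1_seq #|P|) /= ?iota_uniq //; last first.
  by rewrite mem_index_iota cardfE -cardsT.
rewrite pP eqxx [X in _ + X]big1 ?addr0 // => k nk.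
by rewrite eq_sym (negbTE nk) andbF.
Qed.

Lemma horner_partition_poly_induced b G (S : {set vset G}) x :
  (partition_poly b (induced S)).[x] = partition_sum (fun B => b (induced B) * x) S.
Proof.
rewrite horner_partition_poly -[S in RHS]induced_incl_imset partition_sum_imset.
  by apply: eq_bigr => P _; apply: eq_bigr => B _; rewrite induced_induced.
exact: induced_incl_inj.
Qed.

Lemma partition_poly_exponential b : exponential_type (partition_poly b).
Proof.
split=> [|G x y]; first by rewrite /partition_poly eqxx.
under eq_bigr do rewrite !horner_partition_poly_induced.
rewrite -partition_sumD horner_partition_poly.
by apply: eq_bigr => P _; apply: eq_bigr => B _; rewrite mulrDr.
Qed.

Lemma coef1_partition_poly b G : vset G != fset0 -> (partition_poly b G)`_1 = b G.
Proof.
move=> nV0; have nT : [set: vset G] != set0.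
  by rewrite -card_gt0 cardsT -cardfE cardfs_gt0.
rewrite /partition_poly (negbTE nV0) coef_sum.
rewrite (bigD1_seq 1%N) ?iota_uniq ?mem_index_iota ?ltnS ?cardfs_gt0 //=.
rewrite coefZ coefXn eqxx mulr1 big1 ?addr0; last first.
  by move=> k nk; rewrite coefZ coefXn eq_sym (negbTE nk) mulr0.
(* The only partition with one block is the one whose block is the whole vertex set. *)
rewrite /partition_coef (eq_bigl (pred1 [set setT])) => [|P]; last first.
  apply/andP/eqP => [[pP /cards1P[B PB]]|->].
    by rewrite PB -(cover_partition pP) PB cover1.
  rewrite cards1 eqxx; split => //.
  by rewrite /partition cover1 eqxx trivIset1 inE eq_sym.
by rewrite big_pred1_eq big_set1 induced_setT.
Qed.

End PartitionPoly.

(** * Uniqueness from the linear coefficients *)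

Lemma additive_poly_linear (F : numFieldType) (p : {poly F}) :
  (forall x y, p.[x + y] = p.[x] + p.[y]) -> p = p`_1 *: 'X.
Proof.
move=> addp.
suff pE : p = p.[1] *: 'X by rewrite [in RHS]pE coefZ coefX mulr1.
have pn n : p.[n%:R] = p.[1] * n%:R.
  elim: n => [|n IHn]; last by rewrite -natr1 addp IHn mulrDr mulr1.
  by rewrite mulr0; apply: (addIr p.[0]); rewrite -addp !add0r.
apply/eqP; rewrite -subr_eq0; apply/eqP.
set q := p - _.
(* The difference [q] vanishes at 0, ..., [size q] - 1, which are distinct in characteristic zero;
   these are more roots than its degree allows if it is non-zero. *)
apply: (@roots_geq_poly_eq0 _ q [seq n%:R | n <- iota 0 (size q)]).
- apply/allP => _ /mapP[n _ ->]; apply/rootP.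
  by rewrite hornerD hornerN hornerZ hornerX pn subrr.
- by rewrite map_inj_uniq ?iota_uniq // => m n /eqP; rewrite Num.Theory.eqr_nat => /eqP.
- by rewrite size_map size_iota.
Qed.

(* By induction on the number of vertices all the terms of the convolution
   with S and its complement nonempty agree for f and g, so f G - g G is
   additive, hence linear, and its linear coefficient vanishes. *)
Lemma exponential_type_inj (R : realType) (K : choiceType)
    (f g : graph K -> {poly R[i]}) :
  exponential_type f -> exponential_type g ->
  (forall G, vset G != fset0 -> (f G)`_1 = (g G)`_1) ->
  f =1 g.
Proof.
move=> [f0 fD] [g0 gD] fg1 G.
have [n] := ubnP #|` vset G|; elim: n G => // n IHn G ltGn.
have [/eqP/vset0_graph0 ->|nV0] := boolP (vset G == fset0); first by rewrite f0 g0.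
have nT : [set: vset G] != set0 by rewrite -card_gt0 cardsT -cardfE cardfs_gt0.
have IHS (S : {set vset G}) : S != setT -> f (induced S) = g (induced S).
  move=> nS; apply: IHn; rewrite card_induced.
  rewrite ltnS in ltGn; apply: leq_trans ltGn.
  by rewrite cardfE -cardsT proper_card // properT.
suff addd x y : (f G - g G).[x + y] = (f G - g G).[x] + (f G - g G).[y].
  apply/eqP; rewrite -subr_eq0 (additive_poly_linear addd).
  by rewrite coefB fg1 // subrr scale0r.
(* The terms at [setT] and [set0] are distinct since [G] has a vertex, and each has a factor 1 from
   the empty graph. *)
have split_sum (h : graph K -> {poly R[i]}) : h (graph0 K) = 1 ->
    \sum_(S : {set vset G}) (h (induced S)).[x] * (h (induced (~: S))).[y] =
    (h G).[x] + ((h G).[y] + \sum_(S : {set vset G} | (S != setT) && (S != set0))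
       (h (induced S)).[x] * (h (induced (~: S))).[y]).
  move=> h0; rewrite (bigD1 setT) //= (bigD1 set0) /=; last by rewrite eq_sym.
  by rewrite setCT setC0 induced_set0 induced_setT h0 !hornerC mulr1 mul1r.
rewrite !hornerD !hornerN -fD -gD !split_sum //.
rewrite [in LHS](eq_bigr (fun S : {set vset G} =>
   (g (induced S)).[x] * (g (induced (~: S))).[y])); last first.
  (* Both [S] and its complement are proper, so the induction hypothesis covers both factors. *)
  move=> S /andP[nST nS0]; rewrite !IHS //.
  by apply: contra nS0 => /eqP CS; rewrite -(setCK S) CS setCT.
by rewrite addrA [X in _ - X]addrA opprD addrACA subrr addr0 opprD addrACA.
Qed.

Theorem theorem5p1 (R : realType) (K : choiceType) :
  (forall b : graph K -> R[i], exponential_type (partition_poly b)) /\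
  (forall f : graph K -> {poly R[i]}, exponential_type f ->
     forall G : graph K, f G = partition_poly (fun H => (f H)`_1%N) G).
Proof.
split=> [b|f fE]; first exact: partition_poly_exponential.
apply: exponential_type_inj => // [|G nV0]; first exact: partition_poly_exponential.
by rewrite coef1_partition_poly.
Qed.
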